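(* Let $\Omega=\{(q_1,q_2,q_3)\in\mathbb{R}^3 : q_1>q_2>q_3\}$ with the Riemannian metric $g$ whose matrix at $q\in\Omega$ in the coordinates $(q_1,q_2,q_3)$ is $g(q)=E(q)^{-1}$, where $E(q)=(e^{-|q_i-q_j|})_{i,j=1,2,3}$. Consider any $2$-dimensional subspace $\sigma$ of a tangent space $T_q\Omega$, $q\in\Omega$. The sectional curvature $\kappa_\sigma$ of $g$ satisfies $$\kappa_\sigma<\frac14 .$$ Moreover, $\kappa_\sigma$ tends to $0$ as $q_1-q_2\to\infty$ and $q_2-q_3\to\infty$.
   Context: The matrix $E(q)$ is symmetric and positive definite for every $q\in\Omega$, so $g=\sum_{i,j}g_{ij}\,dq_i\,dq_j$ with $(g_{ij})=E(q)^{-1}$ is a Riemannian metric on $\Omega$. The sectional curvature $\kappa_\sigma$ is normalized in the standard way (so that in dimension 2 it equals the Gauss curvature). *)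

(* Defs.v *)
From mathcomp Require Import all_boot all_order all_algebra.
From mathcomp Require Import all_classical all_reals all_analysis.
Import Order.TTheory GRing.Theory Num.Theory.
Import numFieldNormedType.Exports.

Set Implicit Arguments.
Unset Strict Implicit.
Unset Printing Implicit Defensive.

Local Open Scope classical_set_scope.
Local Open Scope ring_scope.

Section RiemannianCoordinates.
Context {R : realType} {n : nat}.

(* A metric in global coordinates, on (a subset of) R^(n+1): its Gram matrix
   (g_ij(q)) in the coordinate frame. Tangent vectors at q are row vectors of
   components in that frame. All the operators below are local, so only the
   germ of g at q matters. *)
Implicit Types (g : 'rV[R]_n.+1 -> 'M[R]_n.+1) (q u v w : 'rV[R]_n.+1).

Definition partial (i : 'I_n.+1) (f : 'rV[R]_n.+1 -> R) q : R :=
  'D_(delta_mx 0 i) f q.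

Definition inner g q u v : R := \sum_i \sum_j g q i j * u 0 i * v 0 j.

(* Gamma^k_ij, the Levi-Civita connection:
   nabla_(d_i) d_j = \sum_k Gamma^k_ij d_k. *)
Definition christoffel g (k i j : 'I_n.+1) q : R :=
  2^-1 * \sum_l invmx (g q) k l *
    (partial i (fun x => g x j l) q + partial j (fun x => g x i l) q
     - partial l (fun x => g x i j) q).

(* The l-th component of R(d_i, d_j) d_k, with the sign convention
   R(X, Y) Z = nabla_X nabla_Y Z - nabla_Y nabla_X Z - nabla_[X, Y] Z. *)
Definition riemann g (l i j k : 'I_n.+1) q : R :=
  partial i (christoffel g l j k) q - partial j (christoffel g l i k) q
  + \sum_m (christoffel g m j k q * christoffel g l i m q
            - christoffel g m i k q * christoffel g l j m q).

Definition curvature_op g q u v w : 'rV[R]_n.+1 :=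
  \row_l \sum_i \sum_j \sum_k riemann g l i j k q * u 0 i * v 0 j * w 0 k.

(* Sectional curvature of the plane spanned by the linearly independent
   vectors u, v; positive on round spheres, and equal to the Gauss curvature
   in dimension 2. *)
Definition sectional_curvature g q u v : R :=
  inner g q (curvature_op g q u v v) u
  / (inner g q u u * inner g q v v - inner g q u v ^+ 2).

End RiemannianCoordinates.

(* The coordinates q_1, q_2, q_3 are q 0 0, q 0 1, q 0 2. *)
Definition Omega (R : realType) : set 'rV[R]_3 :=
  [set q | q 0 0 > q 0 1 /\ q 0 1 > q 0 2].

Definition Emx (R : realType) (q : 'rV[R]_3) : 'M[R]_3 :=
  \matrix_(i, j) expR (- `|q 0 i - q 0 j|).

Definition gmetric (R : realType) (q : 'rV[R]_3) : 'M[R]_3 := invmx (Emx q).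

(* Main.v *)
Require Import Defs.
From mathcomp Require Import all_boot all_order all_algebra.
From mathcomp Require Import all_classical all_reals all_analysis.
From mathcomp Require Import ring lra.
Import Order.TTheory GRing.Theory Num.Theory.
Import numFieldNormedType.Exports.
Local Open Scope classical_set_scope.
Local Open Scope ring_scope.

(** Put a = e^(q_1 - q_0) and b = e^(q_2 - q_1), which lie in (0, 1) on the
    domain.  Then E(q) has entries 1, a, b and ab, its inverse is tridiagonal,
    and completing squares gives

      g = (dq_0 - a dq_1)^2 / (1 - a^2) + dq_1^2 + (dq_2 - b dq_1)^2 / (1 - b^2).

    The coframe dq_0 - a dq_1, dq_1, dq_2 - b dq_1 is thus orthogonal.  In the
    normalized frame (e_0, e_1, e_2) dual to it the only nonzero brackets are
    [e_0, e_1] = - p e_0 and [e_1, e_2] = - m e_2, where p = a / (1 + a) and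
    m = b / (1 + b), so the connection has only the components

      nabla_(e_0) e_0 = p e_1,     nabla_(e_0) e_1 = - p e_0,
      nabla_(e_2) e_2 = - m e_1,   nabla_(e_2) e_1 = m e_2.

    Since e_1 p = p (1 - 2 p), e_1 m = - m (1 - 2 m), e_2 p = 0 and
    e_0 m = 0, the curvature operator is diagonal on bivectors,
    with eigenvalues

      K_01 = p (1 - 3 p),   K_02 = p m,   K_12 = m (1 - 3 m).

    A sectional curvature is therefore a weighted mean of these three numbers
    (sectional_curvature_gmetric).  As p and m lie in (0, 1/2), each of the
    three is smaller than 1/4; as p < a and m < b, each is also at most
    max(a, b) in absolute value, and this tends to 0 when both gaps
    q_0 - q_1 and q_1 - q_2 tend to infinity.

    The definition of the curvature is by Christoffel symbols in the
    coordinates q, so the diagonal form has to be established there.  All the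
    functions that occur are rational in a and b, and both variables satisfy
    linear differential equations (da = (dq_1 - dq_0) a and
    db = (dq_2 - dq_1) b); hence every partial derivative is obtained by a
    symbolic derivation of rational expressions (partial_reval), and each
    entry of the Christoffel symbols (christoffel_gmetric) and of the
    curvature tensor (riemann_gmetric) becomes an identity between rational
    functions of a and b. *)

(** * Symbolic differentiation of rational expressions *)

Section RationalExpressions.
Context {R : realType}.

Inductive ratexp :=
  | VarA | VarB | Cst of int
  | Add of ratexp & ratexp | Mul of ratexp & ratexp | Inv of ratexp.

Fixpoint reval (e : ratexp) (a b : R) : R :=
  match e with
  | VarA => a
  | VarB => b
  | Cst n => n%:~R
  | Add e1 e2 => reval e1 a b + reval e2 a b
  | Mul e1 e2 => reval e1 a b * reval e2 a b
  | Inv e1 => (reval e1 a b)^-1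
  end.

(** Every inverted subexpression has a nonzero value, so the expression is
    smooth near (a, b). *)
Fixpoint rdefined (e : ratexp) (a b : R) : Prop :=
  match e with
  | Add e1 e2 | Mul e1 e2 => rdefined e1 a b /\ rdefined e2 a b
  | Inv e1 => rdefined e1 a b /\ reval e1 a b != 0
  | _ => True
  end.

Fixpoint rderiv (e : ratexp) (a b da db : R) : R :=
  match e with
  | VarA => da
  | VarB => db
  | Cst _ => 0
  | Add e1 e2 => rderiv e1 a b da db + rderiv e2 a b da db
  | Mul e1 e2 => reval e1 a b * rderiv e2 a b da db
                 + reval e2 a b * rderiv e1 a b da db
  | Inv e1 => - (reval e1 a b) ^- 2 * rderiv e1 a b da db
  end.

Lemma is_derive_reval {V : normedModType R} (f g : V -> R) (q v : V)
    (da db : R) (e : ratexp) :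
  is_derive q v f da -> is_derive q v g db -> rdefined e (f q) (g q) ->
  is_derive q v (fun x => reval e (f x) (g x)) (rderiv e (f q) (g q) da db).
Proof.
move=> fda gdb; elim: e => //=.
- by move=> n _; exact: is_derive_cst.
- move=> e1 IH1 e2 IH2 [/IH1 d1 /IH2 d2].
  exact: (@is_deriveD _ _ _ _ _ q v _ _ d1 d2).
- move=> e1 IH1 e2 IH2 [/IH1 d1 /IH2 d2].
  exact: (@is_deriveM _ _ _ _ q v _ _ d1 d2).
- move=> e1 IH1 [/IH1 [d1 d1E] nz].
  split; first exact: derivableV.
  by rewrite (deriveV _ d1)// d1E.
Qed.

End RationalExpressions.

(** A directional derivative is the derivative of the restriction to a line;
    this reduces exponentials of linear forms to the one-variable exponential. *)
Lemma is_derive_along_line {R : realType} {V W : normedModType R}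
    (f : V -> W) (h : R -> W) (q v : V) (d : W) :
  (forall t, f (t *: v + q) = h t) -> is_derive (0 : R) 1 h d ->
  is_derive q v f d.
Proof.
move=> fh [hd <-].
have E : (fun t : R => t^-1 *: ((f \o shift q) (t *: v) - f q)) =
         (fun t : R => t^-1 *: ((h \o shift 0) (t *: (1 : R)) - h 0)).
  apply/funext => t /=.
  by rewrite fh -(fh 0) scale0r add0r [_ *: (1 : R)]mulr1 addr0.
by split; rewrite /derivable /derive E.
Qed.

Lemma is_derive_expR_coordB {R : realType} {n : nat} (i j : 'I_n.+1)
    (q v : 'rV[R]_n.+1) :
  is_derive q v (fun x : 'rV[R]_n.+1 => expR (x 0 i - x 0 j))
    ((v 0 i - v 0 j) * expR (q 0 i - q 0 j)).
Proof.
apply: (@is_derive_along_line _ _ _ _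
  (fun t : R => expR (t * (v 0 i - v 0 j) + (q 0 i - q 0 j)))).
  by move=> t; congr expR; rewrite !mxE; ring.
set c := v 0 i - v 0 j; set d := q 0 i - q 0 j.
have dlin : is_derive (0 : R) 1 (fun t : R => t * c + d) c.
  have -> : (fun t : R => t * c + d) = (id * cst c + cst d)%R by [].
  by apply: is_derive_eq; rewrite /GRing.scale/= mulr0 mulr1 addr0 add0r.
have := @is_derive1_comp _ expR (fun t : R => t * c + d) 0 _ _ _ dlin.
by move/(_ _ (is_derive_expR _)); rewrite /= mul0r add0r mulrC.
Qed.

(** * The metric and its Christoffel symbols as rational expressions *)

Declare Scope ratexp_scope.
Delimit Scope ratexp_scope with rat.
Bind Scope ratexp_scope with ratexp.
Notation "0" := (Cst 0) : ratexp_scope.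
Notation "1" := (Cst 1) : ratexp_scope.
Notation "e + f" := (Add e f) : ratexp_scope.
Notation "e * f" := (Mul e f) : ratexp_scope.
Notation "- e" := (Mul (Cst (-1)) e) : ratexp_scope.
Notation "e - f" := (Add e (Mul (Cst (-1)) f)) : ratexp_scope.
Notation "e / f" := (Mul e (Inv f)) : ratexp_scope.

Definition entry3 (e0 e1 e2 : ratexp) (k : nat) : ratexp :=
  match k with 0%N => e0 | 1%N => e1 | _ => e2 end.

Definition sym3 (e00 e01 e02 e11 e12 e22 : ratexp) (i j : nat) : ratexp :=
  entry3 (entry3 e00 e01 e02 j) (entry3 e01 e11 e12 j) (entry3 e02 e12 e22 j) i.

Definition E_exp : nat -> nat -> ratexp :=
  sym3 1 VarA (VarA * VarB)
         1    VarB
              1.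

Definition metric_exp : nat -> nat -> ratexp :=
  let P := (1 / (1 - VarA * VarA))%rat in
  let Q := (1 / (1 - VarB * VarB))%rat in
  sym3 P (- (VarA * P)) 0
         (P + Q - 1)    (- (VarB * Q))
                        Q.

(** Obtained from the connection in the orthonormal frame: with e_1 the
    vector (a, 1, b), C = p / (1 - a^2) and D = m / (1 - b^2), one has
    nabla_(d_0) d_0 = C (e_1 - a (1 + a) d_0), nabla_(d_0) e_1 = - p d_0 and
    symmetrically for d_2; the other columns follow from
    d_1 = e_1 - a d_0 - b d_2 and nabla_(d_0) d_2 = 0. *)
Definition christoffel_exp (k i j : nat) : ratexp :=
  let A := VarA in let B := VarB in
  let C := (A / ((1 - A) * ((1 + A) * (1 + A))))%rat in
  let D := (B / ((1 - B) * ((1 + B) * (1 + B))))%rat in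
  entry3
    (sym3 (- (C * A * A)) (C * A)               0
                          (- C - D * A * B * B) (D * B * A)
                                                (- (D * A)) i j)
    (sym3 C               (- (C * A))               0
                          (C * A * A - D * B * B)   (D * B)
                                                    (- D) i j)
    (sym3 (C * B)         (- (C * A * B))           0
                          (D + C * A * A * B)       (- (D * B))
                                                    (D * B * B) i j) k.

(** Denominators are products of 1 - a, 1 + a, 1 - a^2 and the same in b,
    which are positive when a and b lie in (0, 1). *)
Ltac gap_nonzero :=
  repeat (apply/andP; split); apply: lt0r_neq0; nra.

Lemma sum3 {V : nmodType} (F : 'I_3 -> V) :
  \sum_(i < 3) F i = F 0 + F 1 + F 2.
Proof.
rewrite !big_ord_recl big_ord0 addr0 addrA.
by congr (F _ + F _ + F _); apply: val_inj.
Qed.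

Lemma forall_ord3 (P : 'I_3 -> Prop) : P 0 -> P 1 -> P 2 -> forall i, P i.
Proof.
move=> P0 P1 P2 [[|[|[|//]]] lti].
- by rewrite (_ : Ordinal lti = 0)//; apply: val_inj.
- by rewrite (_ : Ordinal lti = 1)//; apply: val_inj.
- by rewrite (_ : Ordinal lti = 2)//; apply: val_inj.
Qed.

(** * The metric in the variables a and b *)

Section Metric.
Context {R : realType}.
Implicit Types q v : 'rV[R]_3.

Definition gapA q : R := expR (q 0 1 - q 0 0).
Definition gapB q : R := expR (q 0 2 - q 0 1).

Lemma gapA_itv {q} : Omega q -> 0 < gapA q < 1.
Proof. by case=> h _; rewrite expR_gt0 -expR0 ltr_expR subr_lt0. Qed.

Lemma gapB_itv {q} : Omega q -> 0 < gapB q < 1.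
Proof. by case=> _ h; rewrite expR_gt0 -expR0 ltr_expR subr_lt0. Qed.

Lemma Omega_near {q} : Omega q -> \near q, Omega q.
Proof.
move=> [h01 h12].
have cont i : {for q, continuous (fun x : 'rV[R]_3 => x 0 i)}.
  exact: coord_continuous.
have lt i j : q 0 i < q 0 j -> \forall x \near q, (x : 'rV[R]_3) 0 i < x 0 j.
  move=> h; near=> x; rewrite -subr_gt0; near: x.
  apply: (cvgr_gt (q 0 j - q 0 i)); last by rewrite subr_gt0.
  by apply: cvgB; apply: cont.
by near=> x; split; near: x; exact: lt.
Unshelve. all: by end_near. Qed.

Lemma Emx_Omega {q} : Omega q ->
  Emx q = \matrix_(i, j) reval (E_exp i j) (gapA q) (gapB q).
Proof.
move=> [h01 h12].
have h02 := lt_trans h12 h01.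
have norm i j : q 0 j < q 0 i -> `|q 0 i - q 0 j| = q 0 i - q 0 j.
  by move=> h; rewrite gtr0_norm// subr_gt0.
apply/matrixP; apply: forall_ord3; apply: forall_ord3;
  rewrite !mxE /= ?subrr ?normr0 ?oppr0 ?expR0//;
  rewrite ?(norm _ _ h01, norm _ _ h12, norm _ _ h02)//;
  rewrite 1?distrC ?(norm _ _ h01, norm _ _ h12, norm _ _ h02)//;
  by rewrite /gapA /gapB -?expRD; congr expR; ring.
Qed.

Lemma gmetric_Omega {q} : Omega q ->
  gmetric q = \matrix_(i, j) reval (metric_exp i j) (gapA q) (gapB q).
Proof.
move=> Oq; have /andP[a0 a1] := gapA_itv Oq; have /andP[b0 b1] := gapB_itv Oq.
set G := \matrix_(i, j) _; suff GE : G *m Emx q = 1%:M.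
  have [_ uE] := mulmx1_unit GE.
  by rewrite /gmetric -[LHS]mul1mx -GE -mulmxA mulmxV// mulmx1.
rewrite Emx_Omega// /G; move: (gapA q) (gapB q) a0 a1 b0 b1 => a b a0 a1 b0 b1.
apply/matrixP; apply: forall_ord3; apply: forall_ord3; rewrite !mxE sum3 !mxE /=;
  by field; gap_nonzero.
Qed.
End Metric.

(** * The Christoffel symbols *)

Section Christoffel.
Context {R : realType}.
Implicit Types q v : 'rV[R]_3.

(** The domain is open, so equality on it determines partial derivatives
    there; the last two arguments of the symbolic derivative are the partial
    derivatives of a and b. *)
Lemma partial_reval (f : 'rV[R]_3 -> R) (e : ratexp) (i : 'I_3) q :
  Omega q -> (forall x, Omega x -> f x = reval e (gapA x) (gapB x)) ->
  rdefined e (gapA q) (gapB q) ->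
  partial i f q = rderiv e (gapA q) (gapB q)
    (((i == 1)%:R - (i == 0)%:R) * gapA q)
    (((i == 2)%:R - (i == 1)%:R) * gapB q).
Proof.
move=> Oq fe de; rewrite /partial.
have -> : 'D_(delta_mx 0 i) f q =
    'D_(delta_mx 0 i) (fun x => reval e (gapA x) (gapB x)) q.
  apply: near_eq_derive; near=> x; apply: fe; near: x; exact: Omega_near.
set v := delta_mx 0 i.
have dA : is_derive q v gapA (((i == 1)%:R - (i == 0)%:R) * gapA q).
  apply: is_derive_eq; first exact: is_derive_expR_coordB.
  by rewrite !mxE /= ![_ == i]eq_sym.
have dB : is_derive q v gapB (((i == 2)%:R - (i == 1)%:R) * gapB q).
  apply: is_derive_eq; first exact: is_derive_expR_coordB.
  by rewrite !mxE /= ![_ == i]eq_sym.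
exact: (derive_val (is_derive := is_derive_reval _ _ _ _ _ _ _ dA dB de)).
Unshelve. all: by end_near. Qed.

Lemma metric_exp_defined (i j : 'I_3) (a b : R) :
  0 < a < 1 -> 0 < b < 1 -> rdefined (metric_exp i j) a b.
Proof.
move=> /andP[a0 a1] /andP[b0 b1].
move: i j; apply: forall_ord3; apply: forall_ord3; repeat split=> //=;
  gap_nonzero.
Qed.

Lemma christoffel_exp_defined (k i j : 'I_3) (a b : R) :
  0 < a < 1 -> 0 < b < 1 -> rdefined (christoffel_exp k i j) a b.
Proof.
move=> /andP[a0 a1] /andP[b0 b1].
move: k i j; apply: forall_ord3; apply: forall_ord3; apply: forall_ord3;
  repeat split=> //=; gap_nonzero.
Qed.

Lemma christoffel_gmetric (k i j : 'I_3) q : Omega q ->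
  christoffel (@gmetric R) k i j q
  = reval (christoffel_exp k i j) (gapA q) (gapB q).
Proof.
move=> Oq; have hA := gapA_itv Oq; have hB := gapB_itv Oq.
have dg m n l : partial m (fun x => gmetric x n l) q
    = rderiv (metric_exp n l) (gapA q) (gapB q)
        (((m == 1)%:R - (m == 0)%:R) * gapA q)
        (((m == 2)%:R - (m == 1)%:R) * gapB q).
  apply: partial_reval => //; last exact: metric_exp_defined.
  by move=> x Ox; rewrite gmetric_Omega// mxE.
rewrite /christoffel sum3 !dg /gmetric invmxK (Emx_Omega Oq) !mxE.
move: (gapA q) (gapB q) hA hB => a b /andP[a0 a1] /andP[b0 b1].
move: k i j; apply: forall_ord3; apply: forall_ord3; apply: forall_ord3 => /=.
all: by field; gap_nonzero.
Qed.
End Christoffel.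

(** * The curvature tensor *)

Definition coframe_exp (r i : nat) : ratexp :=
  entry3 (entry3 1 (- VarA) 0 i)
         (entry3 0 1        0 i)
         (entry3 0 (- VarB) 1 i) r.

(** Row r is the vector metrically dual to row r of the coframe: E(q) applied
    to the covector. *)
Definition frame_exp (r l : nat) : ratexp :=
  entry3 (entry3 (1 - VarA * VarA) 0 0    l)
         (entry3 VarA              1 VarB l)
         (entry3 0 0 (1 - VarB * VarB)    l) r.

Section Curvature.
Context {R : realType}.
Implicit Types (q u v w : 'rV[R]_3) (a b : R).

Definition coframe a b (r i : 'I_3) : R := reval (coframe_exp r i) a b.
Definition frame a b (r l : 'I_3) : R := reval (frame_exp r l) a b.

(** The squared length of the covector dq_0 - a dq_1 is 1 - a^2, so this is
    the factor that normalizes its square. *)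
Definition weight a : R := (1 - a ^+ 2)^-1.

(** The eigenvalues p (1 - 3 p) and p m of the curvature operator: the first,
    taken at a or at b, belongs to the two planes that contain e_1, the second
    to the plane of e_0 and e_2. *)
Definition curv_adjacent a : R := a / (1 + a) * (1 - 3 * (a / (1 + a))).
Definition curv_outer a b : R := a / (1 + a) * (b / (1 + b)).

(** The tensor R(x, y) z = (f_r /\ f_s)(x, y) (f_s(z) F_r - f_r(z) F_s), which
    is the curvature tensor of constant curvature concentrated on one
    coordinate plane. *)
Definition curv_summand (f F : 'I_3 -> 'I_3 -> R) (r s l i j k : 'I_3) : R :=
  (f r i * f s j - f s i * f r j) * (F r l * f s k - F s l * f r k).

(** The curvature tensor with the asserted diagonal curvature operator. *)
Definition coord_curv a b (l i j k : 'I_3) : R :=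
  curv_adjacent a * weight a * curv_summand (coframe a b) (frame a b) 0 1 l i j k
  + curv_outer a b * (weight a * weight b)
    * curv_summand (coframe a b) (frame a b) 0 2 l i j k
  + curv_adjacent b * weight b * curv_summand (coframe a b) (frame a b) 2 1 l i j k.

Definition christoffel_deriv (m : 'I_3) a b (k i j : 'I_3) : R :=
  rderiv (christoffel_exp k i j) a b (((m == 1)%:R - (m == 0)%:R) * a)
                                     (((m == 2)%:R - (m == 1)%:R) * b).

(** The curvature tensor computed from the table of Christoffel symbols. *)
Definition christoffel_curv a b (l i j k : 'I_3) : R :=
  christoffel_deriv i a b l j k - christoffel_deriv j a b l i k
  + \sum_(m < 3) (reval (christoffel_exp m j k) a b
                    * reval (christoffel_exp l i m) a b
                  - reval (christoffel_exp m i k) a b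
                    * reval (christoffel_exp l j m) a b).

Lemma riemann_christoffel_curv (l i j k : 'I_3) q : Omega q ->
  riemann (@gmetric R) l i j k q = christoffel_curv (gapA q) (gapB q) l i j k.
Proof.
move=> Oq; have hA := gapA_itv Oq; have hB := gapB_itv Oq.
have dG m l' i' j' : partial m (christoffel (@gmetric R) l' i' j') q
    = christoffel_deriv m (gapA q) (gapB q) l' i' j'.
  apply: partial_reval => //; last exact: christoffel_exp_defined.
  by move=> x Ox; exact: christoffel_gmetric.
rewrite /riemann !dG; congr (_ + _); apply: eq_bigr => m _.
by rewrite !(christoffel_gmetric _ _ _ _ Oq).
Qed.

(* The identities are proved one pair (i, j) at a time: with all the entries
   in a single proof, the cost of each grows with the number already proved. *)
Ltac check_curvature :=
  move=> /andP[a0 a1] /andP[b0 b1];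
  rewrite /christoffel_curv /christoffel_deriv sum3 /coord_curv /curv_summand;
  rewrite /coframe /frame /curv_adjacent /curv_outer /weight;
  match goal with l : 'I_3, k : 'I_3 |- _ => move: l k end;
  apply: forall_ord3; apply: forall_ord3 => /=; by field; gap_nonzero.

Lemma christoffel_curv_01 a b (l k : 'I_3) : 0 < a < 1 -> 0 < b < 1 ->
  christoffel_curv a b l 0 1 k = coord_curv a b l 0 1 k.
Proof. check_curvature. Qed.

Lemma christoffel_curv_02 a b (l k : 'I_3) : 0 < a < 1 -> 0 < b < 1 ->
  christoffel_curv a b l 0 2 k = coord_curv a b l 0 2 k.
Proof. check_curvature. Qed.

Lemma christoffel_curv_12 a b (l k : 'I_3) : 0 < a < 1 -> 0 < b < 1 ->
  christoffel_curv a b l 1 2 k = coord_curv a b l 1 2 k.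
Proof. check_curvature. Qed.

Lemma antisym_eq3 (F G : 'I_3 -> 'I_3 -> R) :
  (forall i j, F j i = - F i j) -> (forall i j, G j i = - G i j) ->
  F 0 1 = G 0 1 -> F 0 2 = G 0 2 -> F 1 2 = G 1 2 -> forall i j, F i j = G i j.
Proof.
move=> Fopp Gopp E01 E02 E12.
have diag (H : 'I_3 -> 'I_3 -> R) i : (forall i j, H j i = - H i j) -> H i i = 0.
  by move=> /(_ i i) h; lra.
apply: forall_ord3; apply: forall_ord3;
  rewrite ?(diag F _ Fopp) ?(diag G _ Gopp)//.
- by rewrite Fopp Gopp E01.
- by rewrite Fopp Gopp E02.
- by rewrite Fopp Gopp E12.
Qed.

(** Both tensors are antisymmetric in i and j, which reduces the identity to
    the three pairs i < j. *)
Lemma riemann_gmetric (l i j k : 'I_3) q : Omega q ->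
  riemann (@gmetric R) l i j k q = coord_curv (gapA q) (gapB q) l i j k.
Proof.
move=> Oq; rewrite riemann_christoffel_curv//.
have hA := gapA_itv Oq; have hB := gapB_itv Oq.
move: i j; apply: (antisym_eq3 (fun i j => christoffel_curv _ _ l i j k)
                               (fun i j => coord_curv _ _ l i j k)).
- move=> i j; rewrite /christoffel_curv opprD opprB -sumrN; congr (_ + _).
  by apply: eq_bigr => m _; rewrite opprB.
- by move=> i j; rewrite /coord_curv /curv_summand; ring.
- exact: christoffel_curv_01.
- exact: christoffel_curv_02.
- exact: christoffel_curv_12.
Qed.

End Curvature.

(** * The sectional curvature as a weighted mean *)

Section SectionalCurvature.
Context {R : realType}.
Implicit Types (q u v w : 'rV[R]_3) (a b : R).

Definition pairing (f : 'I_3 -> R) u : R := \sum_i f i * u 0 i.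

Definition wedge (f : 'I_3 -> 'I_3 -> R) (r s : 'I_3) u v : R :=
  pairing (f r) u * pairing (f s) v - pairing (f s) u * pairing (f r) v.

Lemma curv_summand_contract (f F : 'I_3 -> 'I_3 -> R) (r s l : 'I_3) u v w :
  \sum_i \sum_j \sum_k
    curv_summand f F r s l i j k * u 0 i * v 0 j * w 0 k
  = wedge f r s u v
    * (F r l * pairing (f s) w - F s l * pairing (f r) w).
Proof. by rewrite /curv_summand /wedge /pairing !sum3; ring. Qed.

(** The completed squares. *)
Lemma inner_gmetric q u v : Omega q ->
  let a := gapA q in let b := gapB q in
  inner (@gmetric R) q u v
  = weight a * (pairing (coframe a b 0) u * pairing (coframe a b 0) v)
  + pairing (coframe a b 1) u * pairing (coframe a b 1) v
  + weight b * (pairing (coframe a b 2) u * pairing (coframe a b 2) v).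
Proof.
move=> Oq a b; rewrite /inner gmetric_Omega// -/a -/b.
rewrite /pairing !sum3 !mxE /coframe /weight /=.
move: (gapA_itv Oq) (gapB_itv Oq); rewrite -/a -/b.
clearbody a b => /andP[a0 a1] /andP[b0 b1].
move: (u 0 0) (u 0 1) (u 0 2) (v 0 0) (v 0 1) (v 0 2) => u0 u1 u2 v0 v1 v2.
by field; gap_nonzero.
Qed.

Lemma curvature_op_gmetric q u v w : Omega q ->
  let a := gapA q in let b := gapB q in
  let f := coframe a b in let F := frame a b in
  curvature_op (@gmetric R) q u v w = \row_l
  (curv_adjacent a * weight a * (wedge f 0 1 u v
     * (F 0 l * pairing (f 1) w - F 1 l * pairing (f 0) w))
  + curv_outer a b * (weight a * weight b) * (wedge f 0 2 u v
     * (F 0 l * pairing (f 2) w - F 2 l * pairing (f 0) w))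
  + curv_adjacent b * weight b * (wedge f 2 1 u v
     * (F 2 l * pairing (f 1) w - F 1 l * pairing (f 2) w))).
Proof.
move=> Oq a b f F; apply/rowP => l; rewrite !mxE.
rewrite -!curv_summand_contract !mulr_sumr -!big_split; apply: eq_bigr => i _.
rewrite !mulr_sumr -!big_split; apply: eq_bigr => j _.
rewrite !mulr_sumr -!big_split; apply: eq_bigr => k _ /=.
by rewrite riemann_gmetric// /coord_curv -/a -/b !mulrDl !mulrA.
Qed.

(** The frame vectors are metrically dual to the coframe, which is orthogonal
    with squared lengths 1 - a^2, 1 and 1 - b^2. *)
Lemma pairing_frame a b (c0 c1 c2 : R) (r : 'I_3) (F := frame a b) :
  pairing (coframe a b r) (\row_l (F 0 l * c0 + F 1 l * c1 + F 2 l * c2))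
  = nth 0 [:: (1 - a ^+ 2) * c0; c1; (1 - b ^+ 2) * c2] r.
Proof.
by move: r; apply: forall_ord3;
  rewrite /pairing !sum3 !mxE /F /coframe /frame /=; ring.
Qed.

Lemma inner_curvature_op q u v : Omega q ->
  let a := gapA q in let b := gapB q in let f := coframe a b in
  inner (@gmetric R) q (curvature_op (@gmetric R) q u v v) u
  = curv_adjacent a * (weight a * wedge f 0 1 u v ^+ 2)
  + curv_outer a b * (weight a * weight b * wedge f 0 2 u v ^+ 2)
  + curv_adjacent b * (weight b * wedge f 2 1 u v ^+ 2).
Proof.
move=> Oq a b f; rewrite inner_gmetric// curvature_op_gmetric//.
rewrite -/a -/b -/f; set F := frame a b.
set k01 := curv_adjacent a; set k02 := curv_outer a b; set k21 := curv_adjacent b.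
set f0 := pairing (f 0); set f1 := pairing (f 1); set f2 := pairing (f 2).
set w01 := wedge f 0 1 u v; set w02 := wedge f 0 2 u v.
set w21 := wedge f 2 1 u v.
(* Collecting the coefficients of each frame vector. *)
have -> : (\row_l (k01 * weight a * (w01 * (F 0 l * f1 v - F 1 l * f0 v))
    + k02 * (weight a * weight b) * (w02 * (F 0 l * f2 v - F 2 l * f0 v))
    + k21 * weight b * (w21 * (F 2 l * f1 v - F 1 l * f2 v))))
  = \row_l (
    F 0 l * (k01 * weight a * w01 * f1 v
             + k02 * (weight a * weight b) * w02 * f2 v)
    + F 1 l * (- (k01 * weight a * w01 * f0 v) - k21 * weight b * w21 * f2 v)
    + F 2 l * (k21 * weight b * w21 * f1 v
               - k02 * (weight a * weight b) * w02 * f0 v)) :> 'rV[R]_3.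
  by apply/rowP => l; rewrite !mxE; ring.
rewrite /f0 /f1 /f2 !pairing_frame /= -/f0 -/f1 -/f2.
rewrite /w01 /w02 /w21 /wedge -/f0 -/f1 -/f2 /weight.
move: (gapA_itv Oq) (gapB_itv Oq); rewrite -/a -/b => /andP[a0 a1] /andP[b0 b1].
move: k01 k02 k21 (f0 u) (f1 u) (f2 u) (f0 v) (f1 v) (f2 v) a0 a1 b0 b1.
clear; move: a b => a b k01 k02 k21 u0 u1 u2 v0 v1 v2 a0 a1 b0 b1.
by field; gap_nonzero.
Qed.

(** Lagrange's identity in the orthogonal coframe. *)
Lemma gram_gmetric q u v : Omega q ->
  let a := gapA q in let b := gapB q in let f := coframe a b in
  inner (@gmetric R) q u u * inner (@gmetric R) q v v
    - inner (@gmetric R) q u v ^+ 2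
  = weight a * wedge f 0 1 u v ^+ 2
  + weight a * weight b * wedge f 0 2 u v ^+ 2
  + weight b * wedge f 2 1 u v ^+ 2.
Proof. by move=> Oq a b f; rewrite !inner_gmetric// /wedge -/a -/b -/f; ring. Qed.

(** If all 2 x 2 minors vanish, then any nonzero coordinate of v exhibits u
    as a multiple of v. *)
Lemma free_pair_minor {K : fieldType} {n : nat} (u v : 'rV[K]_n) :
  free [:: u; v] -> exists i j, u 0 i * v 0 j != u 0 j * v 0 i.
Proof.
rewrite free_cons seq1_free span_seq1 => /andP[uv vn0].
have [j vj] : exists j, v 0 j != 0.
  apply/existsP; apply: contra_neqT vn0 => /existsPn v0.
  by apply/rowP => j; rewrite mxE; apply/eqP; move: (v0 j); rewrite negbK.
have [i uvi] : exists i, u 0 i * v 0 j != u 0 j * v 0 i; last by exists i, j.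
apply/existsP; apply: contraNT uv => /existsPn h.
apply/vlineP; exists (u 0 j / v 0 j); apply/rowP => i; rewrite mxE.
by move: (h i); rewrite negbK => /eqP e; apply: (mulIf vj); rewrite e; field.
Qed.

Lemma weight_gt0 a : 0 < a < 1 -> 0 < weight a.
Proof. by move=> /andP[a0 a1]; rewrite invr_gt0; nra. Qed.

(** The coframe changes coordinates unimodularly, so if its three minors
    vanish on (u, v) then so do the coordinate minors of (u, v). *)
Lemma wedges_gt0 a b u v (f := coframe a b) : 0 < a < 1 -> 0 < b < 1 ->
  free [:: u; v] ->
  0 < weight a * wedge f 0 1 u v ^+ 2
    + weight a * weight b * wedge f 0 2 u v ^+ 2
    + weight b * wedge f 2 1 u v ^+ 2.
Proof.
move=> /weight_gt0 wa /weight_gt0 wb /free_pair_minor uv.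
have x0 := mulr_ge0 (ltW wa) (sqr_ge0 (wedge f 0 1 u v)).
have y0 := mulr_ge0 (ltW (mulr_gt0 wa wb)) (sqr_ge0 (wedge f 0 2 u v)).
have z0 := mulr_ge0 (ltW wb) (sqr_ge0 (wedge f 2 1 u v)).
rewrite lt_neqAle eq_sym !addr_ge0// andbT.
apply/negP; rewrite !paddr_eq0 ?addr_ge0// !mulf_eq0 ?sqrf_eq0 ?orbb.
rewrite (gt_eqF wa) (gt_eqF wb) /= => /andP[/andP[/eqP w01 /eqP w02] /eqP w21].
have [i [j /eqP]] := uv; apply.
(* The minor f_0 /\ f_2 involves the coordinate minors multiplied by a and b;
   these multiples make the final elimination linear. *)
have bw01 := congr1 ( *%R b) w01; have aw21 := congr1 ( *%R a) w21.
move: w01 w02 w21 bw01 aw21; rewrite /wedge /pairing !sum3 /f /coframe /=.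
move: i j; apply: forall_ord3; apply: forall_ord3 => // *; lra.
Qed.

Lemma sectional_curvature_gmetric q u v : Omega q -> free [:: u; v] ->
  exists x y z, [/\ 0 <= x, 0 <= y, 0 <= z, 0 < x + y + z &
    sectional_curvature (@gmetric R) q u v
    = (curv_adjacent (gapA q) * x + curv_outer (gapA q) (gapB q) * y
       + curv_adjacent (gapB q) * z) / (x + y + z)].
Proof.
move=> Oq uv; have hA := gapA_itv Oq; have hB := gapB_itv Oq.
have wa := weight_gt0 _ hA; have wb := weight_gt0 _ hB.
pose f := coframe (gapA q) (gapB q).
exists (weight (gapA q) * wedge f 0 1 u v ^+ 2),
  (weight (gapA q) * weight (gapB q) * wedge f 0 2 u v ^+ 2),
  (weight (gapB q) * wedge f 2 1 u v ^+ 2); split.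
- by rewrite mulr_ge0 ?sqr_ge0 ?ltW.
- by rewrite mulr_ge0 ?sqr_ge0 ?ltW// mulr_gt0.
- by rewrite mulr_ge0 ?sqr_ge0 ?ltW.
- exact: wedges_gt0.
- by rewrite /sectional_curvature inner_curvature_op// gram_gmetric.
Qed.

Lemma weighted_mean_lt (k0 k1 k2 x y z M : R) :
  0 <= x -> 0 <= y -> 0 <= z -> 0 < x + y + z ->
  k0 < M -> k1 < M -> k2 < M ->
  (k0 * x + k1 * y + k2 * z) / (x + y + z) < M.
Proof.
move=> x0 y0 z0 s0 h0 h1 h2; rewrite ltr_pdivrMr//.
pose k := Num.max k0 (Num.max k1 k2).
have kM : k < M by rewrite !gt_max h0 h1.
apply: (@le_lt_trans _ _ (k * (x + y + z))); last by rewrite ltr_pM2r.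
by rewrite !mulrDr !lerD// ler_wpM2r// !le_max lexx ?orbT.
Qed.

Lemma weighted_mean_norm_lt (k0 k1 k2 x y z M : R) :
  0 <= x -> 0 <= y -> 0 <= z -> 0 < x + y + z ->
  `|k0| < M -> `|k1| < M -> `|k2| < M ->
  `|(k0 * x + k1 * y + k2 * z) / (x + y + z)| < M.
Proof.
move=> x0 y0 z0 s0; rewrite !ltr_norml.
move=> /andP[l0 u0] /andP[l1 u1] /andP[l2 u2].
apply/andP; split; last exact: weighted_mean_lt.
by rewrite ltrNl -mulNr !opprD -!mulNr weighted_mean_lt// ltrNl.
Qed.

(** * Bounds on the eigenvalues *)

(** The maximum of p (1 - 3 p) over all real p is 1/12. *)
Lemma curv_adjacent_lt a : curv_adjacent a < 1 / 4.
Proof.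
rewrite /curv_adjacent; set p := a / (1 + a); nra.
Qed.

Lemma ratio_bounds a : 0 < a < 1 ->
  [/\ 0 < a / (1 + a), a / (1 + a) < 1 / 2 & a / (1 + a) < a].
Proof.
by move=> /andP[a0 a1]; split; rewrite ?divr_gt0// ?ltr_pdivrMr; nra.
Qed.

Lemma curv_outer_lt a b : 0 < a < 1 -> 0 < b < 1 -> curv_outer a b < 1 / 4.
Proof.
move=> /ratio_bounds[p0 p1 _] /ratio_bounds[m0 m1 _]; rewrite /curv_outer; nra.
Qed.

Lemma norm_curv_adjacent_lt a : 0 < a < 1 -> `|curv_adjacent a| < a.
Proof.
move=> /ratio_bounds[]; rewrite /curv_adjacent; set p := a / (1 + a) => p0 p1 p2.
by rewrite ltr_norml; apply/andP; split; nra.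
Qed.

Lemma norm_curv_outer_lt a b : 0 < a < 1 -> 0 < b < 1 -> `|curv_outer a b| < a.
Proof.
move=> /ratio_bounds[p0 p1 p2] /ratio_bounds[m0 m1 _]; rewrite /curv_outer.
by rewrite ltr_norml; apply/andP; split; nra.
Qed.

End SectionalCurvature.

Theorem proposition4p4 (R : realType) :
  (forall q : 'rV[R]_3, Omega q ->
     forall sigma : {vspace 'rV[R]_3}, \dim sigma = 2%N ->
     forall u v : 'rV[R]_3, basis_of sigma [:: u; v] ->
       sectional_curvature (@gmetric R) q u v < 1 / 4)
  /\
  (forall eps : R, 0 < eps -> exists M : R,
     forall q : 'rV[R]_3, Omega q ->
       M < q 0 0 - q 0 1 -> M < q 0 1 - q 0 2 ->
     forall sigma : {vspace 'rV[R]_3}, \dim sigma = 2%N ->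
     forall u v : 'rV[R]_3, basis_of sigma [:: u; v] ->
       `|sectional_curvature (@gmetric R) q u v| < eps).
Proof.
split=> [q Oq sigma _ u v /basis_free uv|eps eps0].
  have hA := gapA_itv Oq; have hB := gapB_itv Oq.
  have [x [y [z [x0 y0 z0 s0 ->]]]] := sectional_curvature_gmetric q u v Oq uv.
  by apply: weighted_mean_lt; rewrite ?curv_adjacent_lt ?curv_outer_lt.
(* The gaps exceed - ln eps exactly when a and b are smaller than eps. *)
exists (- ln eps) => q Oq hx hy sigma _ u v /basis_free uv.
have hA := gapA_itv Oq; have hB := gapB_itv Oq.
have lt_eps t : - ln eps < - t -> expR t < eps.
  by rewrite ltrN2 => h; rewrite -[ltRHS]lnK ?posrE// ltr_expR.
have aE : gapA q < eps by apply: lt_eps; rewrite opprB.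
have bE : gapB q < eps by apply: lt_eps; rewrite opprB.
have [x [y [z [x0 y0 z0 s0 ->]]]] := sectional_curvature_gmetric q u v Oq uv.
apply: weighted_mean_norm_lt => //.
- exact: lt_trans (norm_curv_adjacent_lt _ hA) aE.
- exact: lt_trans (norm_curv_outer_lt _ _ hA hB) aE.
- exact: lt_trans (norm_curv_adjacent_lt _ hB) bE.
Qed.
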